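(* Let $m\in\mathbb{N}$, $x_1,\ldots,x_m\in\mathcal{X}$ fixed, $B\ge1$, $Y_1,\ldots,Y_m$ independent real random variables with values in $[-B,B]$, $\eta_t=\mathbb{E}[Y_t]$. For $i\in\{1,2\}$, $t\in\{1,\ldots,m+1\}$, $q\in[0,\infty)$, let $\mathcal{H}^{(q)}_{i,t}$ be a set of functions $\mathcal{X}\to[-B,B]$, nondecreasing in $q$ (i.e. $\mathcal{H}^{(q)}_{i,t}\subseteq\mathcal{H}^{(q')}_{i,t}$ for $q<q'$), and let $\mathrm{pen}_i(q,t)\in[0,\infty)$. Let $\rho_m(h,g)=\max_{1\le s\le m}|h(x_s)-g(x_s)|$, and for $\epsilon>0$ let $N_i(\epsilon,q)$ be any number with $N_i(\epsilon,q)\ge\max_{t\in\{1,\ldots,m+1\}}|\mathcal{H}^{(q)}_{i,t,\epsilon}|$, where $\mathcal{H}^{(q)}_{i,t,\epsilon}$ is a minimal $\epsilon$-cover of $\mathcal{H}^{(q)}_{i,t}$ w.r.t. $\rho_m$ (assumed finite). Let $\epsilon_i(q)\in(0,B]$ satisfy $\epsilon_i(q)\le B\sqrt{\ln(N_i(\epsilon_i(q),q))/m}$, and write $N_i(q)=N_i(\epsilon_i(q),q)$. With $R^*,\hat R$ as defined below, let $(\hat h_1,\hat h_2,\hat t,\hat q_1,\hat q_2)$ minimize $m\hat R(h_1,h_2,t_0)+\mathrm{pen}_1(q_1,t_0)+\mathrm{pen}_2(q_2,t_0)$ and $(h_1^*,h_2^*,t^*,q_1^*,q_2^* )$ minimize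 $mR^*(h_1,h_2,t_0)+\mathrm{pen}_1(q_1,t_0)+\mathrm{pen}_2(q_2,t_0)$, both over all $(h_1,h_2,t_0,q_1,q_2)$ with $t_0\in\{1,\ldots,m+1\}$, $q_1,q_2\in[0,\infty)$, $h_1\in\mathcal{H}^{(q_1)}_{1,t_0}$, $h_2\in\mathcal{H}^{(q_2)}_{2,t_0}$ (minimizers assumed to exist). Then for every $\delta\in(0,1)$, with probability at least $1-\delta$, $$R^*(\hat h_1,\hat h_2,\hat t)\le R^*(h_1^*,h_2^*,t^* )+\frac{\mathrm{pen}_1(q_1^*,t^* )+\mathrm{pen}_2(q_2^*,t^* )}{m}+22B^2\sqrt{\frac{2\ln\big(\tfrac{2(m+1)}{\delta}\big)+\sum_{i=1}^2\sum_{q\in\{\hat q_i,q_i^*\}}\ln\big((q+3)^2N_i(\lceil q\rceil)\big)}{m}}.$$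
   Context: For $t_0\in\{1,\ldots,m+1\}$ and functions $h_1,h_2:\mathcal{X}\to[-B,B]$: $R^*(h_1,h_2,t_0)=\frac1m\big(\sum_{t=1}^{t_0-1}(h_1(x_t)-\eta_t)^2+\sum_{t=t_0}^m(h_2(x_t)-\eta_t)^2\big)$ and $\hat R(h_1,h_2,t_0)$ is the same with $Y_t$ in place of $\eta_t$; empty sums are $0$. An $\epsilon$-cover of a set $\mathcal{H}$ w.r.t. $\rho_m$ is a set $C\subseteq\mathcal{H}$ such that every $h\in\mathcal{H}$ has some $g\in C$ with $\rho_m(h,g)\le\epsilon$; minimal means of smallest cardinality. *)

(* Defs.v *)
From HB Require Import structures.
From mathcomp Require Import all_boot all_order all_algebra.
From mathcomp Require Import all_classical all_reals all_analysis.
Set Implicit Arguments. Unset Strict Implicit. Unset Printing Implicit Defensive.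
Import Order.TTheory GRing.Theory Num.Theory.
Local Open Scope classical_set_scope.
Local Open Scope ring_scope.

(* Indices are 1-based as in the paper: x_t, Y_t for t in {1,..,m}, and
   change points t0 in {1,..,m+1}. *)

Definition rho_m {X : Type} {R : realType} (m : nat) (x : nat -> X)
  (h g : X -> R) : R :=
  \big[Num.max/0]_(1 <= s < m.+1) `|h (x s) - g (x s)|.

Definition is_cover {X : Type} {R : realType} (m : nat) (x : nat -> X)
  (H : set (X -> R)) (eps : R) (n : nat) (C : 'I_n -> X -> R) : Prop :=
  (forall k, H (C k)) /\
  (forall h, H h -> exists k, rho_m m x h (C k) <= eps).

Definition has_cover_of_size {X : Type} {R : realType} (m : nat) (x : nat -> X)
  (H : set (X -> R)) (eps : R) (n : nat) : Prop :=
  exists C : 'I_n -> X -> R, is_cover m x H eps C.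

Definition min_cover_card {X : Type} {R : realType} (m : nat) (x : nat -> X)
  (H : set (X -> R)) (eps : R) (n : nat) : Prop :=
  (exists C : 'I_n -> X -> R, injective C /\ is_cover m x H eps C) /\
  (forall n', has_cover_of_size m x H eps n' -> (n <= n')%N).

(* R^*(h1,h2,t0) with eta, and hat R with Y(omega) in place of eta *)
Definition risk {X : Type} {R : realType} (m : nat) (x : nat -> X)
  (eta : nat -> R) (h1 h2 : X -> R) (t0 : nat) : R :=
  (m%:R)^-1 * (\sum_(1 <= t < t0) (h1 (x t) - eta t) ^+ 2
              + \sum_(t0 <= t < m.+1) (h2 (x t) - eta t) ^+ 2).

(* Mutual independence of the real random variables Y_1,...,Y_m
   (product rule for all families of Borel sets; taking A_t = setT
   recovers every subfamily). *)
Definition mutually_independent {d} {T : measurableType d} {R : realType}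
  (P : probability T R) (m : nat) (Y : nat -> T -> R) : Prop :=
  forall A : nat -> set R, (forall t, measurable (A t)) ->
    P (\big[setI/setT]_(1 <= t < m.+1) (Y t @^-1` A t))
    = (\prod_(1 <= t < m.+1) P (Y t @^-1` A t))%E.

(* eta_t = E[Y_t] (as a real number; Y_t is bounded hence integrable) *)
Definition mean {d} {T : measurableType d} {R : realType}
  (P : probability T R) (Y : nat -> T -> R) (t : nat) : R :=
  fine (expectation P (Y t)).

Definition feasible {X : Type} {R : realType} (m : nat)
  (H1 H2 : nat -> R -> set (X -> R))
  (h1 h2 : X -> R) (t0 : nat) (q1 q2 : R) : Prop :=
  [/\ (1 <= t0 <= m.+1)%N, 0 <= q1, 0 <= q2, H1 t0 q1 h1 & H2 t0 q2 h2].

Definition cplx {R : realType} (N : R -> R -> R) (eps : R -> R) (q : R) : R :=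
  let c : R := (Num.ceil q)%:~R in
  ln ((q + 3) ^+ 2 * N (eps c) c).

(* Main.v *)
Require Import Defs.
From HB Require Import structures.
From mathcomp Require Import all_boot all_order all_algebra.
From mathcomp Require Import all_classical all_reals all_analysis.
From mathcomp Require Import ring lra measurable_realfun.
Set Implicit Arguments.
Unset Strict Implicit.
Unset Printing Implicit Defensive.
Import Order.TTheory GRing.Theory Num.Theory.
Local Open Scope classical_set_scope.
Local Open Scope ring_scope.

(** Write f for the concatenation of h1 and h2 at the change point t0. Expanding
    the squares, m R^*(f) and m \hat R(f) differ by 2 sum_t f(x_t) (Y_t - eta_t)
    plus a term free of f, so minimality of \hat f reduces the claim to a bound
    on the noise sum_t (\hat f - f^* )(x_t) (Y_t - eta_t). Round \hat q_i up to
    integers c_i, replace \hat f by an element of the covers at the cost of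
    2 B m max_i eps_i(c_i), and apply Hoeffding's inequality to each of the
    finitely many centers. A union bound over t0, the centers and (c_1, c_2),
    with weights 1 / ((c_1 + 2)^2 (c_2 + 2)^2), makes this uniform. The
    deviation contributes 18 and the discretization 4 to the constant 22. *)

(** * An elementary exponential inequality *)

(** Evaluated at a multiple of a centered variable, the linear term integrates to zero, which leaves
    a sub-Gaussian bound. The constant 5/4 is not sharp; its slack allows a polynomial proof. *)
Lemma expR_le_addr_expR_sqr (R : realType) (x : R) :
  expR x <= x + expR (5 / 4 * x ^+ 2).
Proof.
have e2 : 1 + 5 / 4 * x ^+ 2 <= expR (5 / 4 * x ^+ 2) by exact: expR_ge1Dx.
have [x1|x1] := leP 1 x.
  apply: (@le_trans _ _ (expR (5 / 4 * x ^+ 2))); last by rewrite lerDr; lra.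
  by rewrite ler_expR; nra.
have [xN1|xN1] := leP x (-1).
  have ex : expR x <= 1 by rewrite -(expR0 R) ler_expR; lra.
  by nra.
apply: (@le_trans _ _ (x + (1 + 5 / 4 * x ^+ 2))); last by rewrite lerD2l.
(* Inverting [(1 - y) ^+ 4 <= expR (- x)] bounds [expR x] from above, so that only a polynomial
   inequality in [y] remains. *)
pose y := x / 4.
have xE : x = 4 * y by rewrite /y; lra.
have y1 : -1 / 4 < y < 1 / 4 by rewrite /y; apply/andP; split; lra.
move: y xE y1 => {}y xE y1.
rewrite xE.
have ey : 1 - y <= expR (- y) by exact: expR_ge1Dx.
have y0 : 0 <= 1 - y by lra.
have e4 : (1 - y) ^+ 4 <= expR (- (4 * y)).
  have -> : - (4 * y) = 4%:R * - y by ring.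
  by rewrite expRM_natl; apply: lerXn2r; rewrite ?nnegrE ?expR_ge0.
have p4 : 0 <= 4 * y + (1 + 5 / 4 * (4 * y) ^+ 2) by nra.
have key : 1 <= (4 * y + (1 + 5 / 4 * (4 * y) ^+ 2)) * (1 - y) ^+ 4.
  have -> : (4 * y + (1 + 5 / 4 * (4 * y) ^+ 2)) * (1 - y) ^+ 4
    = 1 + y ^+ 2 * (10 - 60 * y + 105 * y ^+ 2 - 76 * y ^+ 3 + 20 * y ^+ 4).
    by field.
  have y2 : 0 <= y ^+ 2 by exact: sqr_ge0.
  (* The quartic cofactor is the sum of [q], [r] and [20 * y ^+ 4]; the first two are nonnegative
     because [y < 1 / 4]. *)
  have q : 0 <= 10 - 60 * y + 86 * y ^+ 2 by nra.
  have r : 0 <= y ^+ 2 * (19 - 76 * y) by apply: mulr_ge0 => //; lra.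
  have y4 : 0 <= y ^+ 4 by exact: exprn_even_ge0.
  rewrite lerDl; apply: mulr_ge0 => //; lra.
have -> : expR (4 * y) = (expR (- (4 * y)))^-1 by rewrite expRN invrK.
rewrite -[leLHS]mul1r ler_pdivrMr ?expR_gt0//.
apply: (le_trans key); exact: ler_wpM2l.
Qed.

(** * Expectations of products of functions of independent variables *)

Section integral_mul_comp.
Import HBNNSimple.

(** The standard extension from indicators: linearity gives simple functions, monotone convergence
    gives nonnegative measurable ones. In the application [F] is the product of the remaining
    factors. *)
Lemma ge0_integral_mul_comp d (T : measurableType d) (R : realType)
    (mu : {measure set T -> \bar R}) (F : T -> R) (Y : T -> R) (c : R) (f : R -> R) :
  measurable_fun setT F -> (forall w, 0 <= F w) -> measurable_fun setT Y ->
  measurable_fun setT f -> (forall y, 0 <= f y) ->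
  (forall A, measurable A ->
    \int[mu]_w (F w * \1_A (Y w))%:E = c%:E * \int[mu]_w (\1_A (Y w))%:E)%E ->
  (\int[mu]_w (F w * f (Y w))%:E = c%:E * \int[mu]_w (f (Y w))%:E)%E.
Proof.
move=> mF F0 mY mf f0 FA.
have mf' : measurable_fun setT (EFin \o f) by exact/measurable_EFinP.
pose g := nnsfun_approx measurableT mf'.
have mgY n : measurable_fun setT (g n \o Y) by exact: measurableT_comp.
have gcvg y : ((g n y)%:E @[n --> \oo] --> (f y)%:E)%classic.
  by apply: (cvg_nnsfun_approx measurableT mf') => // z _; rewrite lee_fin.
have gnd y : {homo (fun n => g n y) : n m / (n <= m)%N >-> n <= m}.
  by move=> n m nm; exact/lefP/nd_nnsfun_approx.
(* The weight [H] is left free: the two sides of the goal are the cases [H = F] and [H = 1],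
   compared at the end by uniqueness of limits. *)
have mc (H : T -> R) : measurable_fun setT H -> (forall w, 0 <= H w) ->
  (\int[mu]_w (H w * g n (Y w))%:E @[n --> \oo] -->
    \int[mu]_w (H w * f (Y w))%:E)%E%classic.
  move=> mH H0.
  have -> : (\int[mu]_w (H w * f (Y w))%:E =
      \int[mu]_w limn (fun n => (H w * g n (Y w))%:E))%E.
    apply: eq_integral => w _; apply/esym/cvg_lim => //.
    by under eq_fun do rewrite EFinM; rewrite EFinM; exact: cvgeZl.
  apply: cvg_monotone_convergence => //.
  - by move=> n; apply/measurable_EFinP; apply: measurable_funM => //; exact: mgY.
  - by move=> n w _; rewrite lee_fin mulr_ge0.
  - by move=> w _ n m nm; rewrite lee_fin ler_wpM2l// gnd.
have simple (H : T -> R) n : measurable_fun setT H -> (forall w, 0 <= H w) ->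
    (\int[mu]_w (H w * g n (Y w))%:E = \sum_(r \in range (g n))
      (r%:E * \int[mu]_w (H w * \1_(g n @^-1` [set r]) (Y w))%:E))%E.
  move=> mH H0.
  have mHi r : measurable_fun setT (fun w => H w * \1_(g n @^-1` [set r]) (Y w)).
    by apply: measurable_funM => //; apply: measurableT_comp.
  transitivity (\sum_(r \in range (g n))
     (\int[mu]_w (r%:E * (H w * \1_(g n @^-1` [set r]) (Y w))%:E)))%E; last first.
    apply: eq_fsbigr => r /set_mem [y _ <-].
    rewrite ge0_integralZl_EFin//; first by move=> w _; rewrite lee_fin mulr_ge0.
    exact/measurable_EFinP.
  rewrite -ge0_integral_fsum//.
  - apply: eq_integral => w _; rewrite fimfunE mulr_fsumr -fsumEFin//.
    by apply: eq_fsbigr => r _; rewrite -EFinM mulrCA.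
  - by move=> r; apply/measurable_EFinP/measurable_funM.
  - move=> r w _; rewrite -EFinM lee_fin mulrCA mulr_ge0// indicE.
    have [|_] := boolP (Y w \in _); last by rewrite mulr0.
    by rewrite inE/= => <-; rewrite mulr1.
have := mc (cst 1) (measurable_cst _) (fun=> ler01).
under eq_fun do under eq_integral do rewrite /= mul1r.
under [X in _ --> X]eq_integral do rewrite /= mul1r.
move=> /(cvgeZl (y := c%:E) erefl) h2.
have h1 := mc F mF F0.
apply: (cvg_unique _ h1) => //; apply: cvg_trans h2.
rewrite (_ : (fun n => _) = (fun n => c%:E * \int[mu]_w (g n (Y w))%:E))%E//.
apply/funext => n; rewrite simple//.
have := simple (cst 1) n (measurable_cst _) (fun=> ler01).
under eq_integral do rewrite /= mul1r.
(* Distributing [c] over the sum requires nonnegative terms; a negative [r] has empty preimage under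
   [g n], so its term is 0. *)
move=> ->; rewrite ge0_mule_fsumr; last first.
  move=> r; have [r0|r0] := leP 0 r.
    by rewrite mule_ge0 ?lee_fin//; apply: integral_ge0 => w _; rewrite lee_fin mulr_ge0.
  rewrite preimage_nnfun0//.
  by under eq_integral do rewrite indicE in_set0 /= mulr0; rewrite integral0 mule0.
apply: eq_fsbigr => r _; rewrite FA//.
by under [in RHS]eq_integral do rewrite /= mul1r; rewrite muleCA.
Qed.

End integral_mul_comp.

Lemma indic_bigcap_prod (I T : Type) (R : realType) (s : seq I) (A : I -> set T) w :
  \1_(\big[setI/setT]_(i <- s) A i) w = \prod_(i <- s) \1_(A i) w :> R.
Proof.
elim: s => [|i s IH]; first by rewrite !big_nil indicT.
by rewrite !big_cons indicI/= IH.
Qed.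

Lemma integral_prod_indep d (T : measurableType d) (R : realType)
    (P : probability T R) m (Y : nat -> T -> R) (f : nat -> R -> R) :
  (forall t, (1 <= t <= m)%N -> measurable_fun setT (Y t)) ->
  mutually_independent P m Y ->
  (forall t, measurable_fun setT (f t)) -> (forall t y, 0 <= f t y) ->
  (forall t, (1 <= t <= m)%N -> (\int[P]_w (f t (Y t w))%:E)%E \is a fin_num) ->
  (\int[P]_w (\prod_(1 <= t < m.+1) f t (Y t w))%:E =
   \prod_(1 <= t < m.+1) \int[P]_w (f t (Y t w))%:E)%E.
Proof.
move=> mY ind mf f0 ffin.
have inr t : (t \in index_iota 1 m.+1) = (1 <= t <= m)%N.
  by rewrite mem_index_iota ltnS.
have mfY (g : R -> R) t : (1 <= t <= m)%N -> measurable_fun setT g ->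
    measurable_fun setT (fun w => g (Y t w)).
  by move=> tm mg; apply: measurableT_comp => //; exact: mY.
(* Starting from indicators, which is the definition of independence, the
   factors are replaced one index [k] at a time by nonnegative functions. *)
suff indicators (k : nat) (g : nat -> R -> R) : (forall t, measurable_fun setT (g t)) ->
    (forall t y, 0 <= g t y) ->
    (forall t, (1 <= t <= m)%N -> (\int[P]_w (g t (Y t w))%:E)%E \is a fin_num) ->
    (forall t, (1 <= t <= m)%N -> (k <= t)%N ->
       exists2 A : set R, measurable A & g t = \1_A) ->
    (\int[P]_w (\prod_(1 <= t < m.+1) g t (Y t w))%:E =
     \prod_(1 <= t < m.+1) \int[P]_w (g t (Y t w))%:E)%E.
  apply: (indicators m.+1) => // t /andP[_ tm] mt.
  by move: (leq_ltn_trans tm mt); rewrite ltnn.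
elim: k g => [|k IH] g mg g0 gfin gind.
  (* Independence is stated for families indexed by all of [nat], hence the default [setT] outside
     [1..m]. *)
  have : forall t, exists A : set R, measurable A /\ ((1 <= t <= m)%N -> g t = \1_A).
    move=> t; have [tm|_] := boolP (1 <= t <= m)%N; last by exists setT.
    by have [A mA gA] := gind t tm isT; exists A.
  move=> /choice[A /all_and2[mA gA]].
  have mYA t : (1 <= t <= m)%N -> measurable (Y t @^-1` A t).
    by move=> tm; rewrite -[X in measurable X]setTI; exact: mY.
  transitivity (P (\big[setI/setT]_(1 <= t < m.+1) (Y t @^-1` A t))).
    rewrite -[X in P X]setIT -integral_indic//; last first.
      by rewrite big_seq; apply: bigsetI_measurable => t; rewrite inr => /mYA.
    apply: eq_integral => w _; rewrite indic_bigcap_prod; congr EFin.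
    by apply: eq_big_seq => t; rewrite inr => /gA ->.
  rewrite ind//; apply: eq_big_seq => t; rewrite inr => tm.
  rewrite -[X in P X]setIT -integral_indic//; last exact: mYA.
  by rewrite gA.
have [km|km] := boolP (1 <= k <= m)%N; last first.
  apply: IH => // t tm; rewrite leq_eqVlt => /orP[/eqP kt|kt]; last exact: gind.
  by rewrite kt tm in km.
have split_k (S : Type) (idx : S) (op : Monoid.com_law idx) (h : nat -> S) :
    \big[op/idx]_(1 <= t < m.+1) h t =
    op (\big[op/idx]_(1 <= t < m.+1 | t != k) h t) (h k).
  by rewrite (bigD1_seq k) ?inr ?iota_uniq//= Monoid.mulmC.
pose F w := \prod_(1 <= t < m.+1 | t != k) g t (Y t w).
pose c := (\prod_(1 <= t < m.+1 | t != k) \int[P]_w (g t (Y t w))%:E)%E.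
(* Finiteness of each factor makes [c] a real scalar, as the extension from indicators requires. *)
have cfin : c \is a fin_num.
  by rewrite /c big_seq_cond prode_fin_num// => t; rewrite inr => /andP[+ _]; exact: gfin.
have mF : measurable_fun setT F.
  rewrite /F; under eq_fun do rewrite -big_filter.
  apply: measurable_prod => t; rewrite mem_filter inr => /andP[_ tm].
  exact: mfY.
under eq_integral do rewrite split_k -/(F _).
rewrite split_k -/c -(fineK cfin).
apply: ge0_integral_mul_comp => //.
- by move=> w; apply: prodr_ge0.
- exact: mY.
- move=> A mA; rewrite (fineK cfin).
  (* With an indicator put at [k], all factors from index [k] on are indicators and the induction
     hypothesis applies. *)
  pose g' t : R -> R := if t == k then \1_A else g t.
  have g'k : g' k = \1_A by rewrite /g' eqxx.
  have g'E t : t != k -> g' t = g t by rewrite /g' => /negbTE ->.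
  have intA : (\int[P]_w (\1_A (Y k w))%:E = P (Y k @^-1` A))%E.
    rewrite -[X in P X]setIT -integral_indic//.
    by rewrite -[X in measurable X]setTI; exact: mY.
  transitivity (\int[P]_w (\prod_(1 <= t < m.+1) g' t (Y t w))%:E)%E.
    apply: eq_integral => w _; rewrite split_k g'k.
    by congr (_ * _)%:E; apply: eq_bigr => t /g'E ->.
  rewrite IH.
  + by rewrite split_k g'k; congr (_ * _)%E; apply: eq_bigr => t /g'E ->.
  + move=> t; rewrite /g'; case: ifP => // _; exact: measurable_indic.
  + by move=> t y; rewrite /g'; case: ifP.
  + move=> t tm; rewrite /g'; case: ifP => [/eqP ->|_]; last exact: gfin.
    by rewrite intA fin_num_measure// -[X in measurable X]setTI; exact: mY.
  + move=> t tm kt; rewrite /g'; case: ifP => [_|/negbT tk]; first by exists A.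
    by apply: gind => //; rewrite ltn_neqAle eq_sym tk.
Qed.

(** * Moment generating function of a bounded centered variable *)

Section bounded_variable.
Context d (T : measurableType d) (R : realType) (P : probability T R).
Variables (Y : T -> R) (B : R).
Hypothesis mY : measurable_fun setT Y.
Hypothesis Y_le : forall w, - B <= Y w <= B.

Lemma bounded_integrable : P.-integrable setT (EFin \o Y).
Proof.
apply: measurable_bounded_integrable => //.
  by rewrite (le_lt_trans (probability_le1 _ _)) ?ltry.
exists B; split; first exact: num_real.
by move=> M BM w _ /=; rewrite ler_norml; have := Y_le w; lra.
Qed.

Lemma expectation_fineK : ((fine 'E_P[Y])%:E = \int[P]_w (Y w)%:E)%E.
Proof.
rewrite unlock fineK//; apply: integrable_fin_num => //.
exact: bounded_integrable.
Qed.

Lemma expectation_bounded : - B <= fine 'E_P[Y] <= B.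
Proof.
have cstE (c : R) : (\int[P]_w (cst c%:E w) = c%:E)%E.
  by rewrite integral_cst//= probability_setT mule1.
have ic (c : R) : P.-integrable setT (EFin \o cst c).
  exact: finite_measure_integrable_cst.
have iY := bounded_integrable.
rewrite -!lee_fin !expectation_fineK -(cstE B) -(cstE (- B)).
apply/andP; split; apply: le_integral; rewrite ?iY ?[_.-integrable _ _]ic//.
  by move=> w _; rewrite lee_fin; have /andP[] := Y_le w.
by move=> w _; rewrite lee_fin; have /andP[] := Y_le w.
Qed.

Lemma norm_centered_le w : `|Y w - fine 'E_P[Y]| <= 2 * B.
Proof.
have := Y_le w; have := expectation_bounded; rewrite ler_norml; lra.
Qed.

(** Integrates [expR_le_addr_expR_sqr] at [a * (Y w - eta)]: the linear part has mean zero and the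
    quadratic part is bounded through [norm_centered_le]. *)
Lemma integral_expR_centered_le (a : R) :
  (\int[P]_w (expR (a * (Y w - fine 'E_P[Y])))%:E
    <= (expR (5 / 4 * (a * (2 * B)) ^+ 2))%:E)%E.
Proof.
set eta := fine _; set K := expR _.
have iY : P.-integrable setT (fun w => (a * Y w)%:E).
  by under eq_fun do rewrite EFinM; apply: integrableZl => //; exact: bounded_integrable.
have ic : P.-integrable setT (EFin \o cst (K - a * eta)).
  exact: finite_measure_integrable_cst.
(* The bound [K] is rewritten as the integral of [a * (Y w - eta) + K], so that a pointwise
   comparison suffices. *)
have <- : (\int[P]_w ((fun w => (a * Y w)%R%:E) \+ (EFin \o cst (K - a * eta)%R)) w = K%:E)%E.
  rewrite integralD//= integral_cst//= probability_setT mule1.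
  under eq_integral do rewrite EFinM.
  rewrite integralZl//; last exact: bounded_integrable.
  by rewrite -expectation_fineK -/eta -EFinM -EFinD; congr EFin; ring.
apply: ge0_le_integral => //.
- apply/measurable_EFinP; apply: measurableT_comp => //.
  by apply: measurable_funM => //; apply: measurable_funB.
- by apply: emeasurable_funD; [exact: measurable_int iY|exact: measurable_int ic].
- move=> w _; rewrite /= -EFinD lee_fin.
  have := expR_le_addr_expR_sqr (a * (Y w - eta)).
  have : expR (5 / 4 * (a * (Y w - eta)) ^+ 2) <= K.
    rewrite ler_expR ler_wpM2l ?divr_ge0//.
    rewrite (exprMn _ a (Y w - eta)) (exprMn _ a (2 * B)) ler_wpM2l ?sqr_ge0//.
    rewrite -[leLHS]real_normK ?num_real//.
    have YB := norm_centered_le w.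
    by rewrite lerXn2r// nnegrE (le_trans (normr_ge0 _) YB).
  by lra.
Qed.

End bounded_variable.

(** * Tail bound for weighted sums of independent variables *)

Lemma measurable_centered_sum d (T : measurableType d) (R : realType) m
    (Y : nat -> T -> R) (g a : nat -> R) :
  (forall t, (1 <= t <= m)%N -> measurable_fun setT (Y t)) ->
  measurable_fun setT (fun w => \sum_(1 <= t < m.+1) g t * (Y t w - a t)).
Proof.
move=> mY.
(* Outside [1..m] the variable is replaced by 0, since [Y t] is assumed measurable only in that
   range. *)
rewrite (_ : (fun w => _) = fun w => \sum_(1 <= t < m.+1)
    g t * ((if (1 <= t <= m)%N then Y t w else 0) - a t)).
  apply: measurable_sum => t; apply: measurable_funM => //.
  apply: measurable_funB => //.
  have [tm|tm] := boolP (1 <= t <= m)%N; [exact: mY|exact: measurable_cst].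
by apply/funext => w; apply: eq_big_nat => t; rewrite ltnS => ->.
Qed.

(* Chernoff's bound at [l = s / (10 m C^2 B^2)]; the constant 20, instead of the
   optimal 2, comes from the crude [expR_le_addr_expR_sqr]. *)
Lemma hoeffding_tail d (T : measurableType d) (R : realType)
    (P : probability T R) m (Y : nat -> T -> R) (g : nat -> R) (B C s : R) :
  (0 < m)%N -> 0 < B -> 0 < C -> 0 < s ->
  (forall t, (1 <= t <= m)%N -> measurable_fun setT (Y t)) ->
  (forall t w, (1 <= t <= m)%N -> - B <= Y t w <= B) ->
  mutually_independent P m Y ->
  (forall t, (1 <= t <= m)%N -> `|g t| <= C) ->
  (P [set w | (s <= \sum_(1 <= t < m.+1) g t * (Y t w - mean P Y t))%R]
    <= (expR (- (s ^+ 2 / (20 * m%:R * C ^+ 2 * B ^+ 2))))%:E)%E.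
Proof.
move=> m0 B0 C0 s0 mY Yle ind gle.
have m0' : 0 < m%:R :> R by rewrite ltr0n.
have inr t : (t \in index_iota 1 m.+1) = (1 <= t <= m)%N.
  by rewrite mem_index_iota ltnS.
pose S w := \sum_(1 <= t < m.+1) g t * (Y t w - mean P Y t).
have mS : measurable_fun setT S by exact: measurable_centered_sum.
pose X : {RV P >-> R} := mfun_Sub (mem_set mS : S \in mfun).
pose l := s / (10 * m%:R * C ^+ 2 * B ^+ 2).
have D0 : 0 < m%:R * C ^+ 2 * B ^+ 2 by rewrite !mulr_gt0// exprn_gt0.
have l0 : 0 < l by rewrite divr_gt0// !mulr_gt0// exprn_gt0.
apply: (le_trans (chernoff X s l0)).
have -> : 'M_P X l = (\prod_(1 <= t < m.+1)
    \int[P]_w (expR (l * g t * (Y t w - mean P Y t)))%:E)%E.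
  rewrite -(integral_prod_indep (f := fun t y => expR (l * g t * (y - mean P Y t))))//.
  - rewrite /mmt_gen_fun unlock; apply: eq_integral => w _.
    rewrite /= -expR_sum mulrC mulr_sumr; congr (expR _)%:E.
    by apply: eq_bigr => t _; rewrite mulrA.
  - move=> t; apply: measurableT_comp => //; apply: measurable_funM => //.
    exact: measurable_funB.
  - move=> t tm; rewrite ge0_fin_numE.
      apply: le_lt_trans (integral_expR_centered_le P (mY t tm) (fun w => Yle t w tm) _) _.
        exact: ltry.
    by apply: integral_ge0 => w _; rewrite lee_fin expR_ge0.
(* For this [l], the exponent [5 * m * l^2 * C^2 * B^2 - l * s] equals the target; written as a
   product over [t], it can be compared factor by factor. *)
have -> : (expR (- (s ^+ 2 / (20 * m%:R * C ^+ 2 * B ^+ 2))))%:E =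
    (\prod_(1 <= t < m.+1) (expR (5 * l ^+ 2 * C ^+ 2 * B ^+ 2))%:E
      * (expR (- (l * s)))%:E)%E.
  rewrite prodEFin -EFinM -expR_sum -expRD sumr_const_nat subn1/=.
  congr (expR _)%:E; rewrite -mulr_natl /l; field.
  by rewrite !lt0r_neq0.
rewrite lee_wpmul2r ?lee_fin ?expR_ge0//.
rewrite big_seq [leRHS]big_seq.
(* Nonnegativity is carried along in the induction, because multiplying the inequalities requires
   it. *)
suff /andP[] : (0 <= \prod_(t <- index_iota 1 m.+1 | t \in index_iota 1 m.+1)
    \int[P]_w (expR (l * g t * (Y t w - mean P Y t)))%:E
  <= \prod_(t <- index_iota 1 m.+1 | t \in index_iota 1 m.+1)
    (expR (5 * l ^+ 2 * C ^+ 2 * B ^+ 2))%:E)%E by [].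
elim/big_ind2: _ => [|x1 x2 y1 y2 /andP[x0 xy] /andP[x0' xy']|t].
- by rewrite lee01 lexx.
- by rewrite mule_ge0// lee_pmul.
rewrite inr => tm; apply/andP; split.
  by apply: integral_ge0 => w _; rewrite lee_fin expR_ge0.
apply: le_trans (integral_expR_centered_le P (mY t tm) (fun w => Yle t w tm) _) _.
rewrite lee_fin ler_expR.
have -> : 5 / 4 * (l * g t * (2 * B)) ^+ 2 = 5 * l ^+ 2 * (g t) ^+ 2 * B ^+ 2 by field.
have l2 : 0 <= 5 * l ^+ 2 by rewrite mulr_ge0// sqr_ge0.
rewrite ler_wpM2r ?sqr_ge0//; apply: ler_wpM2l => //.
by rewrite -[leLHS]real_normK ?num_real// lerXn2r ?nnegrE ?gle// ltW.
Qed.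

(** * Finite and countable union bounds *)

Lemma measure_bigsetU_le d (T : measurableType d) (R : realType)
    (mu : {measure set T -> \bar R}) (I : eqType) (s : seq I) (A : I -> set T) (K : R) :
  (forall i, measurable (A i)) -> (forall i, i \in s -> mu (A i) <= K%:E)%E ->
  (mu (\big[setU/set0]_(i <- s) A i) <= ((size s)%:R * K)%:E)%E.
Proof.
move=> mA; elim: s => [|i s IH] AK; first by rewrite big_nil measure0 mul0r.
rewrite big_cons /= mulrSr mulrDl mul1r addrC EFinD.
apply: (le_trans (measureU2 _ _ _)) => //; first exact: bigsetU_measurable.
apply: leeD; first by rewrite AK ?mem_head.
by apply: IH => j js; rewrite AK ?inE ?js ?orbT.
Qed.

(* The weights are dominated by the telescoping [1 / (n + 1) - 1 / (n + 2)]. *)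
Lemma measure_bigcup_inv_sqr_le d (T : measurableType d) (R : realType)
    (mu : {measure set T -> \bar R}) (A : nat -> set T) (K : R) :
  0 <= K -> (forall n, measurable (A n)) ->
  (forall n, mu (A n) <= (K / (n%:R + 2) ^+ 2)%:E)%E ->
  (mu (\bigcup_n A n) <= K%:E)%E.
Proof.
move=> K0 mA AK.
have mcup : measurable (\bigcup_n A n) by exact: bigcup_measurable.
apply: (le_trans (generalized_Boole_inequality mu mA mcup)).
apply: lime_le; first exact: is_cvg_nneseries.
apply: nearW => n.
apply: (@le_trans _ _ (\sum_(0 <= i < n) (K * (- (i.+1%:R + 1)^-1 - - (i%:R + 1)^-1))%:E)%E).
  apply: lee_sum => i _; apply: (le_trans (AK i)); rewrite lee_fin ler_wpM2l//.
  have i0 : 0 <= i%:R :> R by [].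
  rewrite -subr_ge0 -[i.+1%:R]natr1; set D := (X in 0 <= X).
  have -> : D = ((i%:R + 1) * (i%:R + 2) ^+ 2)^-1.
    by rewrite /D; field; rewrite !lt0r_neq0//; lra.
  by rewrite invr_ge0 mulr_ge0 ?sqr_ge0//; lra.
rewrite sumEFin -mulr_sumr (telescope_sumr (fun i => - (i%:R + 1)^-1))// lee_fin.
by rewrite add0r invr1 opprK -[leRHS]mulr1 ler_wpM2l// gerDr oppr_le0 invr_ge0 addr_ge0.
Qed.

(** * Concatenated predictors and the basic inequality *)

Section glue.
Context (X : Type) (R : realType) (m : nat) (x : nat -> X).

(** A function of the index rather than of the point: [x] may repeat values on the two sides of the
    change point. *)
Definition glue (h1 h2 : X -> R) (t0 t : nat) : R :=
  if (t < t0)%N then h1 (x t) else h2 (x t).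

Lemma norm_glue_le (B : R) h1 h2 t0 t :
  (forall z, - B <= h1 z <= B) -> (forall z, - B <= h2 z <= B) ->
  `|glue h1 h2 t0 t| <= B.
Proof. by move=> h1B h2B; rewrite ler_norml /glue; case: ifP. Qed.

Lemma risk_glue eta h1 h2 t0 : (1 <= t0 <= m.+1)%N ->
  risk m x eta h1 h2 t0 =
  m%:R^-1 * \sum_(1 <= t < m.+1) (glue h1 h2 t0 t - eta t) ^+ 2.
Proof.
move=> /andP[t01 t0m]; congr (_ * _); rewrite [RHS](big_cat_nat t01 t0m).
congr (_ + _); apply: eq_big_nat => t /andP[ta tb]; rewrite /glue ?tb//.
by rewrite ltnNge ta.
Qed.

Lemma rho_m_ge (h g : X -> R) t : (1 <= t <= m)%N ->
  `|h (x t) - g (x t)| <= rho_m m x h g.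
Proof.
move=> tm; rewrite /rho_m.
by apply: (@le_bigmax_seq _ _ _ _ 0 t xpredT (fun s => `|h (x s) - g (x s)|));
  rewrite ?mem_index_iota ?ltnS.
Qed.

(** Purely deterministic: it turns minimality for the data [y] into a risk bound for [eta] plus a
    noise term. The minimizer's penalty [p] is dropped by nonnegativity. *)
Lemma excess_risk_le (eta y : nat -> R) h1 h2 t0 h1' h2' t0' (p p' : R) :
  (0 < m)%N -> (1 <= t0 <= m.+1)%N -> (1 <= t0' <= m.+1)%N -> 0 <= p ->
  m%:R * risk m x y h1 h2 t0 + p <= m%:R * risk m x y h1' h2' t0' + p' ->
  risk m x eta h1 h2 t0 <= risk m x eta h1' h2' t0' + p' / m%:R +
    2 / m%:R * \sum_(1 <= t < m.+1)
      (glue h1 h2 t0 t - glue h1' h2' t0' t) * (y t - eta t).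
Proof.
move=> m0 t0m t0m' p0; rewrite !risk_glue//.
have m0' : 0 < m%:R :> R by rewrite ltr0n.
have m_neq0 := lt0r_neq0 m0'.
rewrite !mulVKf// => le_emp.
rewrite -(ler_pM2l m0') mulVKf//.
have -> (a b c : R) : m%:R * (m%:R^-1 * a + b / m%:R + 2 / m%:R * c) = a + b + 2 * c.
  by field.
(* The last sum is free of [f] and cancels between the two predictors. *)
have expand (f : nat -> R) : \sum_(1 <= t < m.+1) (f t - eta t) ^+ 2 =
    \sum_(1 <= t < m.+1) (f t - y t) ^+ 2
    + 2 * (\sum_(1 <= t < m.+1) f t * (y t - eta t))
    + \sum_(1 <= t < m.+1) (eta t ^+ 2 - y t ^+ 2).
  rewrite mulr_sumr -!big_split/=; apply: eq_bigr => t _; ring.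
rewrite !expand.
have -> : \sum_(1 <= t < m.+1)
      (glue h1 h2 t0 t - glue h1' h2' t0' t) * (y t - eta t)
    = \sum_(1 <= t < m.+1) glue h1 h2 t0 t * (y t - eta t)
      - \sum_(1 <= t < m.+1) glue h1' h2' t0' t * (y t - eta t).
  by rewrite -sumrB; apply: eq_bigr => t _; rewrite mulrBl.
lra.
Qed.

End glue.

(** * Uniform deviation bounds over covers *)

(** Only pairs of centers enter the exceptional set, so outside it [h1] and [h2] may depend on [w].
    Passing to centers changes each of the [m] summands by at most a radius times [2 * B]. *)
Lemma cover_deviation d (T : measurableType d) (X : Type) (R : realType)
    (P : probability T R) m (x : nat -> X) (Y : nat -> T -> R) (B : R)
    (H1 H2 : set (X -> R)) e1 e2 n1 n2 t0 (f : nat -> R) (s : R) :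
  (0 < m)%N -> 0 < B -> 0 < s ->
  (forall t, (1 <= t <= m)%N -> measurable_fun setT (Y t)) ->
  (forall t w, (1 <= t <= m)%N -> - B <= Y t w <= B) ->
  mutually_independent P m Y ->
  (forall h, H1 h -> forall z, - B <= h z <= B) ->
  (forall h, H2 h -> forall z, - B <= h z <= B) ->
  has_cover_of_size m x H1 e1 n1 -> has_cover_of_size m x H2 e2 n2 ->
  (forall t, `|f t| <= B) ->
  exists A : set T, [/\ measurable A,
    (P A <= ((n1 * n2)%:R * expR (- (s ^+ 2 / (80 * m%:R * B ^+ 4))))%:E)%E &
    forall w, ~ A w -> forall h1 h2, H1 h1 -> H2 h2 ->
      \sum_(1 <= t < m.+1) (glue x h1 h2 t0 t - f t) * (Y t w - mean P Y t)
      <= s + m%:R * (Num.max e1 e2 * (2 * B))].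
Proof.
move=> m0 B0 s0 mY Yle ind H1B H2B [C1 [C1H C1cov]] [C2 [C2H C2cov]] fB.
pose S (h1 h2 : X -> R) w :=
  \sum_(1 <= t < m.+1) (glue x h1 h2 t0 t - f t) * (Y t w - mean P Y t).
pose bad (k : 'I_n1 * 'I_n2) := [set w | s <= S (C1 k.1) (C2 k.2) w].
have mS h1 h2 : measurable_fun setT (S h1 h2) by exact: measurable_centered_sum.
have mbad k : measurable (bad k).
  by rewrite -[X in measurable X]setTI; apply: measurable_fun_le.
exists (\big[setU/set0]_(k <- enum {: 'I_n1 * 'I_n2}) bad k); split.
- exact: bigsetU_measurable.
- have -> : (n1 * n2)%N = size (enum {: 'I_n1 * 'I_n2}).
    by rewrite -cardE card_prod !card_ord.
  apply: measure_bigsetU_le => // k _.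
  (* The weights are differences of two values in [[-B, B]]; [C = 2 * B] turns [20 * C^2 * B^2] into
     [80 * B^4]. *)
  have B20 : 0 < 2 * B by rewrite mulr_gt0.
  apply: le_trans (hoeffding_tail m0 B0 B20 s0 mY Yle ind _) _.
    move=> t _; apply: (le_trans (ler_normB _ _)).
    by rewrite [leRHS]mulrDl !mul1r lerD// norm_glue_le//; [apply: H1B|apply: H2B].
  rewrite lee_fin ler_expR lerN2 le_eqVlt; apply/orP; left; apply/eqP.
  by congr (_ / _); ring.
move=> w; rewrite -bigcup_seq => wbad h1 h2 Hh1 Hh2.
have [k1 h1k1] := C1cov h1 Hh1; have [k2 h2k2] := C2cov h2 Hh2.
have Slt : S (C1 k1) (C2 k2) w <= s.
  rewrite leNgt; apply/negP => sS; apply: wbad; exists (k1, k2).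
    by rewrite /= mem_enum.
  exact: ltW.
(* Both concatenations switch at the same [t0], so at each index a single cover is involved. *)
have gap t : (1 <= t <= m)%N ->
    `|glue x h1 h2 t0 t - glue x (C1 k1) (C2 k2) t0 t| <= Num.max e1 e2.
  move=> tm; rewrite le_max /glue; case: ifP => _; apply/orP; [left|right].
    exact: le_trans (rho_m_ge _ _ _ tm) h1k1.
  exact: le_trans (rho_m_ge _ _ _ tm) h2k2.
rewrite -/(S h1 h2 w) -lerBlDl; apply: le_trans (lerB (lexx _) Slt) _.
rewrite /S -sumrB; apply: (@le_trans _ _
  (\sum_(1 <= t < m.+1) Num.max e1 e2 * (2 * B))); last first.
  by rewrite sumr_const_nat subn1 /= -[leLHS]mulr_natl.
rewrite big_nat_cond [leRHS]big_nat_cond; apply: ler_sum => t.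
rewrite andbT ltnS => tm; rewrite -mulrBl.
apply: le_trans (ler_norm _) _; rewrite normrM ler_pM//.
- apply: le_trans (gap t tm); rewrite le_eqVlt; apply/orP; left; apply/eqP.
  by congr `|_|; ring.
- exact: (norm_centered_le P (mY t tm) (fun w => Yle t w tm)).
Qed.

(** Makes the rounded levels natural numbers, over which a countable union bound is possible. *)
Lemma ceil_natE (R : realType) (q : R) : 0 <= q ->
  exists c : nat, [/\ (Num.ceil q)%:~R = c%:R :> R, q <= c%:R & c%:R < q + 1].
Proof.
move=> q0; exists `|Num.ceil q|%N.
have c0 : 0 <= Num.ceil q by rewrite ceil_ge0; lra.
have -> : `|Num.ceil q|%:R = (Num.ceil q)%:~R :> R by rewrite natr_absz ger0_norm.
have /andP[] := ceil_itv q; rewrite intrB => lb ub; split=> //.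
by rewrite -ltrBlDr.
Qed.

(** Each triple [(t0, c1, c2)] receives the share [K c1 c2] of [delta]. The logarithms in the
    deviation pay for that share and for the number of centers. *)
Lemma uniform_deviation d (T : measurableType d) (X : Type) (R : realType)
    (P : probability T R) m (x : nat -> X) (Y : nat -> T -> R) (B : R)
    (H1 H2 : nat -> nat -> set (X -> R)) (e1 e2 v1 v2 : nat -> R)
    (f : nat -> R) (delta : R) :
  let w_ (v : nat -> R) c := ln ((c%:R + 2) ^+ 2 * v c) in
  (0 < m)%N -> 0 < B -> 0 < delta < 1 ->
  (forall t, (1 <= t <= m)%N -> measurable_fun setT (Y t)) ->
  (forall t w, (1 <= t <= m)%N -> - B <= Y t w <= B) ->
  mutually_independent P m Y ->
  (forall t c h, (1 <= t <= m.+1)%N -> H1 t c h -> forall z, - B <= h z <= B) ->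
  (forall t c h, (1 <= t <= m.+1)%N -> H2 t c h -> forall z, - B <= h z <= B) ->
  (forall c, 1 < v1 c) -> (forall c, 1 < v2 c) ->
  (forall t c, (1 <= t <= m.+1)%N ->
     exists2 n, has_cover_of_size m x (H1 t c) (e1 c) n & n%:R <= v1 c) ->
  (forall t c, (1 <= t <= m.+1)%N ->
     exists2 n, has_cover_of_size m x (H2 t c) (e2 c) n & n%:R <= v2 c) ->
  (forall t, `|f t| <= B) ->
  exists A : set T, [/\ measurable A, (P A <= delta%:E)%E &
    forall w, ~ A w -> forall t0 c1 c2 h1 h2, (1 <= t0 <= m.+1)%N ->
      H1 t0 c1 h1 -> H2 t0 c2 h2 ->
      \sum_(1 <= t < m.+1) (glue x h1 h2 t0 t - f t) * (Y t w - mean P Y t)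
      <= 9 * B ^+ 2 * m%:R *
           Num.sqrt ((ln (m.+1%:R / delta) + w_ v1 c1 + w_ v2 c2) / m%:R)
         + m%:R * (Num.max (e1 c1) (e2 c2) * (2 * B))].
Proof.
move=> w_ m0 B0 /andP[d0 d1] mY Yle ind H1B H2B v11 v21 cov1 cov2 fB.
have m0' : 0 < m%:R :> R by rewrite ltr0n.
have c2_gt0 (c : nat) : 0 < c%:R + 2 :> R by rewrite ltr_wpDl.
have wE v c : 1 < v c -> expR (w_ v c) = (c%:R + 2) ^+ 2 * v c.
  by move=> v1c; rewrite lnK// posrE mulr_gt0// ?exprn_gt0// (lt_trans _ v1c).
have w_gt0 v c : 1 < v c -> 0 < w_ v c.
  move=> v1c; rewrite ln_gt0//; apply: (lt_le_trans v1c).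
  rewrite ler_peMl ?(ltW (lt_trans ltr01 v1c))// exprn_ege1//.
  by have := ler0n R c; lra.
pose lam c1 c2 := ln (m.+1%:R / delta) + w_ v1 c1 + w_ v2 c2.
have md : 1 <= m.+1%:R / delta.
  by rewrite ler_pdivlMr// mul1r (le_trans (ltW d1))// ler1n.
have lam_gt0 c1 c2 : 0 < lam c1 c2.
  by rewrite addr_gt0 ?w_gt0// ltr_wpDl ?w_gt0// ln_ge0.
(* The factor 9 is chosen because [9^2 = 81 >= 80]: the tail exponent becomes [81 / 80 * lam], at
   least [lam]. *)
pose s c1 c2 := 9 * B ^+ 2 * m%:R * Num.sqrt (lam c1 c2 / m%:R).
have s_gt0 c1 c2 : 0 < s c1 c2.
  by rewrite !mulr_gt0 ?exprn_gt0// sqrtr_gt0 divr_gt0.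
pose K c1 c2 := delta / m.+1%:R / (c1%:R + 2) ^+ 2 / (c2%:R + 2) ^+ 2.
have tailK c1 c2 n1 n2 : n1%:R <= v1 c1 -> n2%:R <= v2 c2 ->
    (n1 * n2)%:R * expR (- (s c1 c2 ^+ 2 / (80 * m%:R * B ^+ 4))) <= K c1 c2.
  move=> nv1 nv2.
  have v10 : 0 < v1 c1 by rewrite (lt_trans _ (v11 c1)).
  have v20 : 0 < v2 c2 by rewrite (lt_trans _ (v21 c2)).
  have -> : K c1 c2 = v1 c1 * v2 c2 * expR (- lam c1 c2).
    rewrite expRN !expRD !wE// lnK ?posrE ?divr_gt0// /K; field.
    by rewrite !lt0r_neq0.
  rewrite natrM; apply: ler_pM; rewrite ?mulr_ge0 ?expR_ge0 ?ler_pM//.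
  rewrite ler_expR lerN2 /s exprMn sqr_sqrtr; last first.
    by rewrite ltW// divr_gt0.
  have -> : (9 * B ^+ 2 * m%:R) ^+ 2 * (lam c1 c2 / m%:R) / (80 * m%:R * B ^+ 4)
    = 81 / 80 * lam c1 c2 by field; rewrite !lt0r_neq0.
  by have := lam_gt0 c1 c2; lra.
have K_ge0 c1 c2 : 0 <= K c1 c2.
  by rewrite /K !mulr_ge0 ?invr_ge0 ?sqr_ge0 ?ltW.
(* One exceptional set per triple, empty when [t0] is out of range. *)
have : forall u : nat * nat * nat, exists A : set T,
    [/\ measurable A, (P A <= (K u.1.2 u.2)%:E)%E &
     (1 <= u.1.1 <= m.+1)%N -> forall w, ~ A w -> forall h1 h2,
     H1 u.1.1 u.1.2 h1 -> H2 u.1.1 u.2 h2 ->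
     \sum_(1 <= t < m.+1) (glue x h1 h2 u.1.1 t - f t) * (Y t w - mean P Y t)
      <= s u.1.2 u.2 + m%:R * (Num.max (e1 u.1.2) (e2 u.2) * (2 * B))].
  move=> [[t0 c1] c2] /=.
  have [t0m|_] := boolP (1 <= t0 <= m.+1)%N; last first.
    by exists set0; split=> //; rewrite measure0 lee_fin.
  have [n1 cov1n nv1] := cov1 t0 c1 t0m; have [n2 cov2n nv2] := cov2 t0 c2 t0m.
  have [A [mA PA Adev]] := cover_deviation t0 m0 B0 (s_gt0 c1 c2) mY Yle ind
    (fun h => H1B t0 c1 h t0m) (fun h => H2B t0 c2 h t0m) cov1n cov2n fB.
  exists A; split=> //.
  by apply: (le_trans PA); rewrite lee_fin tailK.
move=> /choice[A Aprop].
have mA u : measurable (A u) by have [] := Aprop u.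
pose At c1 c2 := \big[setU/set0]_(t0 <- index_iota 1 m.+2) A (t0, c1, c2).
have mAt c1 c2 : measurable (At c1 c2) by apply: bigsetU_measurable.
have mAc c1 : measurable (\bigcup_c2 At c1 c2) by exact: bigcup_measurable.
exists (\bigcup_c1 \bigcup_c2 At c1 c2); split.
- exact: bigcup_measurable.
- apply: measure_bigcup_inv_sqr_le => //; first exact: ltW.
  move=> c1; apply: measure_bigcup_inv_sqr_le => //.
    by rewrite divr_ge0 ?sqr_ge0// ltW.
  move=> c2; apply: le_trans (measure_bigsetU_le _ (K := K c1 c2) _) _ => //.
    by move=> t0 _; have [] := Aprop (t0, c1, c2).
  rewrite lee_fin size_iota subn1 /= /K le_eqVlt; apply/orP; left; apply/eqP.
  by field; rewrite !lt0r_neq0// ltr0n.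
move=> w wA t0 c1 c2 h1 h2 t0m Hh1 Hh2.
have [_ _ /(_ t0m w)] := Aprop (t0, c1, c2); apply => //.
move=> wA'; apply: wA; exists c1 => //; exists c2 => //.
rewrite /At -bigcup_seq; exists t0 => //=.
by rewrite mem_index_iota ltnS.
Qed.

(** * The oracle inequality for the penalized minimizer *)

Theorem theoremA1
  (X : Type) (R : realType) (d : measure_display) (T : measurableType d)
  (P : probability T R)
  (m : nat) (hm : (0 < m)%N) (x : nat -> X) (B : R) (hB : 1 <= B)
  (Y : nat -> T -> R)
  (hYmeas : forall t, (1 <= t <= m)%N -> measurable_fun setT (Y t))
  (hYbd : forall t w, (1 <= t <= m)%N -> - B <= Y t w <= B)
  (hind : mutually_independent P m Y)
  (H1 H2 : nat -> R -> set (X -> R))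
  (hH1 : forall t q h, (1 <= t <= m.+1)%N -> 0 <= q -> H1 t q h ->
           forall z, - B <= h z <= B)
  (hH2 : forall t q h, (1 <= t <= m.+1)%N -> 0 <= q -> H2 t q h ->
           forall z, - B <= h z <= B)
  (hmono1 : forall t q q', (1 <= t <= m.+1)%N -> 0 <= q -> q < q' ->
           H1 t q `<=` H1 t q')
  (hmono2 : forall t q q', (1 <= t <= m.+1)%N -> 0 <= q -> q < q' ->
           H2 t q `<=` H2 t q')
  (pen1 pen2 : R -> nat -> R)
  (hpen1 : forall q t, 0 <= q -> (1 <= t <= m.+1)%N -> 0 <= pen1 q t)
  (hpen2 : forall q t, 0 <= q -> (1 <= t <= m.+1)%N -> 0 <= pen2 q t)
  (N1 N2 : R -> R -> R)
  (hN1 : forall eps q, 0 < eps -> 0 <= q -> forall t, (1 <= t <= m.+1)%N ->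
           exists n, min_cover_card m x (H1 t q) eps n /\ n%:R <= N1 eps q)
  (hN2 : forall eps q, 0 < eps -> 0 <= q -> forall t, (1 <= t <= m.+1)%N ->
           exists n, min_cover_card m x (H2 t q) eps n /\ n%:R <= N2 eps q)
  (eps1 eps2 : R -> R)
  (heps1 : forall q, 0 <= q -> 0 < eps1 q <= B /\
           eps1 q <= B * Num.sqrt (ln (N1 (eps1 q) q) / m%:R))
  (heps2 : forall q, 0 <= q -> 0 < eps2 q <= B /\
           eps2 q <= B * Num.sqrt (ln (N2 (eps2 q) q) / m%:R))
  (h1h h2h : T -> X -> R) (th : T -> nat) (q1h q2h : T -> R)
  (hhat : forall w,
     feasible m H1 H2 (h1h w) (h2h w) (th w) (q1h w) (q2h w) /\
     forall h1 h2 t0 q1 q2, feasible m H1 H2 h1 h2 t0 q1 q2 ->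
       m%:R * risk m x (fun t => Y t w) (h1h w) (h2h w) (th w)
         + pen1 (q1h w) (th w) + pen2 (q2h w) (th w)
       <= m%:R * risk m x (fun t => Y t w) h1 h2 t0 + pen1 q1 t0 + pen2 q2 t0)
  (h1s h2s : X -> R) (ts : nat) (q1s q2s : R)
  (hstar : feasible m H1 H2 h1s h2s ts q1s q2s /\
     forall h1 h2 t0 q1 q2, feasible m H1 H2 h1 h2 t0 q1 q2 ->
       m%:R * risk m x (mean P Y) h1s h2s ts + pen1 q1s ts + pen2 q2s ts
       <= m%:R * risk m x (mean P Y) h1 h2 t0 + pen1 q1 t0 + pen2 q2 t0) :
  forall delta : R, 0 < delta < 1 ->
  exists E : set T, measurable E /\ ((1 - delta)%:E <= P E)%E /\
    forall w, E w ->
      risk m x (mean P Y) (h1h w) (h2h w) (th w)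
      <= risk m x (mean P Y) h1s h2s ts
         + (pen1 q1s ts + pen2 q2s ts) / m%:R
         + 22 * B ^+ 2 * Num.sqrt
             ((2 * ln (2 * (m.+1)%:R / delta)
               + (cplx N1 eps1 (q1h w) + cplx N1 eps1 q1s)
               + (cplx N2 eps2 (q2h w) + cplx N2 eps2 q2s)) / m%:R).

Proof.
move=> delta d01.
have B0 : 0 < B by exact: lt_le_trans hB.
have m0' : 0 < m%:R :> R by rewrite ltr0n.
have [[ts_m q1s0 q2s0 Hs1 Hs2] _] := hstar.
(* If [N <= 1], the logarithm is nonpositive, the square root is 0 by convention, and [eps > 0]
   fails. *)
have N_gt1 (N : R -> R -> R) (eps : R -> R) :
    (forall q, 0 <= q -> 0 < eps q <= B /\
       eps q <= B * Num.sqrt (ln (N (eps q) q) / m%:R)) ->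
    forall q, 0 <= q -> 1 < N (eps q) q.
  move=> heps q q0; have [/andP[e0 _] le_e] := heps q q0.
  rewrite ltNge; apply/negP => Nle1.
  move: (lt_le_trans e0 le_e).
  by rewrite ler0_sqrtr ?mulr0 ?ltxx// pmulr_lle0 ?invr_gt0// ln_le0.
have N1_gt1 := N_gt1 _ _ heps1; have N2_gt1 := N_gt1 _ _ heps2.
have cov (H : nat -> R -> set (X -> R)) (N : R -> R -> R) (eps : R -> R) :
    (forall q, 0 <= q -> 0 < eps q <= B /\
       eps q <= B * Num.sqrt (ln (N (eps q) q) / m%:R)) ->
    (forall eps q, 0 < eps -> 0 <= q -> forall t, (1 <= t <= m.+1)%N ->
       exists n, min_cover_card m x (H t q) eps n /\ n%:R <= N eps q) ->
    forall t (c : nat), (1 <= t <= m.+1)%N ->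
      exists2 n, has_cover_of_size m x (H t c%:R) (eps c%:R) n
        & n%:R <= N (eps c%:R) c%:R.
  move=> heps hN t c tm; have [/andP[e0 _] _] := heps c%:R (ler0n _ _).
  have [n [[[C [_ Ccov]] _] nN]] := hN _ c%:R e0 (ler0n _ _) t tm.
  by exists n => //; exists C.
pose f := glue x h1s h2s ts.
have fB t : `|f t| <= B.
  by apply: norm_glue_le; [apply: hH1 Hs1|apply: hH2 Hs2].
have [A [mA PA Adev]] := uniform_deviation
  (H1 := fun t c => H1 t c%:R) (H2 := fun t c => H2 t c%:R)
  (v1 := fun c => N1 (eps1 c%:R) c%:R) (v2 := fun c => N2 (eps2 c%:R) c%:R)
  hm B0 d01 hYmeas hYbd hind
  (fun t c h tm => hH1 t c%:R h tm (ler0n _ _))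
  (fun t c h tm => hH2 t c%:R h tm (ler0n _ _))
  (fun c => N1_gt1 c%:R (ler0n _ _)) (fun c => N2_gt1 c%:R (ler0n _ _))
  (cov _ _ _ heps1 hN1) (cov _ _ _ heps2 hN2) fB.
exists (~` A); split; first exact: measurableC.
split.
  by rewrite probability_setC// EFinB leeB.
move=> w wA.
have [[th_m q1h0 q2h0 Hh1 Hh2] hmin] := hhat w.
have le_emp := hmin _ _ _ _ _ hstar.1.
have pen_ge0 : 0 <= pen1 (q1h w) (th w) + pen2 (q2h w) (th w).
  by rewrite addr_ge0 ?hpen1 ?hpen2.
rewrite -!addrA in le_emp.
apply: le_trans (excess_risk_le (mean P Y) hm th_m ts_m pen_ge0 le_emp) _.
rewrite lerD2l.
(* From [c < q + 1] follows [c + 2 <= q + 3], so the weight of the union bound is absorbed into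
   [cplx]. *)
have cplxE (N : R -> R -> R) (eps : R -> R) q : 0 <= q ->
    (forall q, 0 <= q -> 1 < N (eps q) q) ->
    exists c : nat, [/\ q <= c%:R, 0 < ln (N (eps c%:R) c%:R),
      ln (N (eps c%:R) c%:R) <= ln ((c%:R + 2) ^+ 2 * N (eps c%:R) c%:R) &
      ln ((c%:R + 2) ^+ 2 * N (eps c%:R) c%:R) <= cplx N eps q].
  move=> q0 Ngt1; have [c [cE qc cq]] := ceil_natE q0.
  have Nc1 := Ngt1 c%:R (ler0n _ _).
  have c0 := ler0n R c.
  have N0 : 0 < N (eps c%:R) c%:R by exact: lt_trans Nc1.
  have c20 : 0 < (c%:R + 2 : R) ^+ 2 by rewrite exprn_gt0//; lra.
  have q30 : 0 < (q + 3 : R) ^+ 2 by rewrite exprn_gt0//; lra.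
  exists c; split=> //; first by rewrite ln_gt0.
    rewrite ler_ln ?posrE ?mulr_gt0// ler_peMl ?(ltW N0)//.
    by rewrite exprn_ege1//; lra.
  have q3 : 0 < q + 3 by lra.
  rewrite /cplx/= cE ler_ln ?posrE ?mulr_gt0// ler_wpM2r ?(ltW N0)//.
  by rewrite lerXn2r ?nnegrE//; lra.
have cplx_ge0 (N : R -> R -> R) (eps : R -> R) q : 0 <= q ->
    (forall q, 0 <= q -> 1 < N (eps q) q) -> 0 <= cplx N eps q.
  by move=> q0 Ngt1; have [c [_ h1 h2 h3]] := cplxE _ _ _ q0 Ngt1; lra.
have [c1 [qc1 lnN1 le_w1 le_cplx1]] := cplxE _ _ _ q1h0 N1_gt1.
have [c2 [qc2 lnN2 le_w2 le_cplx2]] := cplxE _ _ _ q2h0 N2_gt1.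
have cplx1s := cplx_ge0 _ _ _ q1s0 N1_gt1.
have cplx2s := cplx_ge0 _ _ _ q2s0 N2_gt1.
(* Monotonicity in [q] moves the selected functions to the integer level. *)
have up (H : nat -> R -> set (X -> R)) q (c : nat) h : 0 <= q -> q <= c%:R ->
    (forall t q q', (1 <= t <= m.+1)%N -> 0 <= q -> q < q' -> H t q `<=` H t q') ->
    H (th w) q h -> H (th w) c%:R h.
  move=> q0; rewrite le_eqVlt => /orP[/eqP <-//|qc] mono; exact: mono.
have dev := Adev w wA (th w) c1 c2 _ _ th_m
  (up _ _ _ _ q1h0 qc1 hmono1 Hh1) (up _ _ _ _ q2h0 qc2 hmono2 Hh2).
set L := 2 * ln _ + _ + _.
have [d0 d1] := andP d01.
have ln_md : 0 <= ln (m.+1%:R / delta) <= ln (2 * m.+1%:R / delta).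
  have md : 1 <= m.+1%:R / delta.
    by rewrite ler_pdivlMr// mul1r (le_trans (ltW d1))// ler1n.
  rewrite ln_ge0//= ler_ln ?posrE ?divr_gt0 ?mulr_gt0//.
  by rewrite -mulrA ler_peMl ?divr_ge0 ?(ltW d0)//; lra.
have [ln_md0 ln_md1] := andP ln_md.
have le_sqrt (a : R) : a <= L -> Num.sqrt (a / m%:R) <= Num.sqrt (L / m%:R).
  by move=> aL; rewrite ler_wsqrtr// ler_pM2r ?invr_gt0.
set r := Num.sqrt (L / m%:R).
(* The condition on the radii is used at the rounded levels, where [ln N] is at most [cplx], hence
   at most [L]. *)
have eps_le : Num.max (eps1 c1%:R) (eps2 c2%:R) <= B * r.
  have [_ le1] := heps1 c1%:R (ler0n _ _); have [_ le2] := heps2 c2%:R (ler0n _ _).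
  rewrite ge_max; apply/andP; split.
    by apply: (le_trans le1); rewrite ler_pM2l// le_sqrt// /L; lra.
  by apply: (le_trans le2); rewrite ler_pM2l// le_sqrt// /L; lra.
rewrite -/f; apply: (@le_trans _ _ (2 / m%:R *
    (9 * B ^+ 2 * m%:R * r + m%:R * (B * r * (2 * B))))).
  rewrite ler_wpM2l ?divr_ge0//; apply: (le_trans dev); apply: lerD.
    apply: ler_wpM2l; first by rewrite !mulr_ge0// ltW.
    by apply: le_sqrt; rewrite /L; lra.
  apply: ler_wpM2l => //; apply: ler_wpM2r => //.
  by rewrite mulr_ge0// ltW.
(* The two contributions are [18 * B^2 * r] and [4 * B^2 * r]. *)
rewrite le_eqVlt; apply/orP; left; apply/eqP; field.
by rewrite lt0r_neq0.
Qed.
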